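(* Let $F$ be an algebraically closed field with $\mathrm{char}\,F\neq2,3$, and let $C(F)$ be the matrix (split) Cayley--Dickson algebra over $F$. Then $\mathrm{rb}_\lambda(C(F))=3$ for all $\lambda\in F$.
   Context: $C(F)=M_2(F)\oplus vM_2(F)$ is the $8$-dimensional algebra whose product extends that of $M_2(F)$ by $a(vb)=v(\bar a b)$, $(vb)a=v(ab)$, $(va)(vb)=b\bar a$ for $a,b\in M_2(F)$, where for $a=(a_{ij})\in M_2(F)$, $\bar a=\begin{pmatrix}a_{22}&-a_{12}\\-a_{21}&a_{11}\end{pmatrix}$. For an algebra $A$ over $F$ (not necessarily associative) and $\lambda\in F$, a linear operator $R\colon A\to A$ is a Rota--Baxter operator of weight $\lambda$ if $R(x)R(y)=R(R(x)y+xR(y)+\lambda xy)$ for all $x,y\in A$. The Rota--Baxter $\lambda$-index of $A$ is $$\mathrm{rb}_\lambda(A)=\min\{m\in\mathbb N\mid \text{for every Rota--Baxter operator } R \text{ of weight }\lambda\text{ on }A\text{ there exists } 0\le k\le m \text{ with } R^k(R+\lambda\,\mathrm{id})^{m-k}=0\},$$ and $\mathrm{rb}_\lambda(A)=\infty$ if no such $m$ exists. *)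

(* Defs.v *)
From HB Require Import structures.
From mathcomp Require Import all_boot all_order all_algebra.
From mathcomp Require Import boolp.

Set Implicit Arguments.
Unset Strict Implicit.
Unset Printing Implicit Defensive.

Import GRing.Theory.
Local Open Scope ring_scope.

Section RotaBaxter.

(* A (not necessarily associative or unital) F-algebra is a module A together
   with a bilinear product mul. *)
Variables (F : fieldType) (A : lmodType F) (mul : {bilinear A -> A -> A}).

Definition rota_baxter (lam : F) (R : {linear A -> A}) : Prop :=
  forall x y : A,
    mul (R x) (R y) = R (mul (R x) y + mul x (R y) + lam *: mul x y).

Definition rb_bound (lam : F) (m : nat) : Prop :=
  forall R : {linear A -> A}, rota_baxter lam R ->
  exists2 k : nat, (k <= m)%N &
    forall x : A, iter k R (iter (m - k) (fun y => R y + lam *: y) x) = 0.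

(* The Rota-Baxter index as an element of nat + {infinity}: Some m is the
   finite value m, None is infinity. *)
Definition rb_index (lam : F) : option nat :=
  match pselect (exists m : nat, `[< rb_bound lam m >]) with
  | left bounded => Some (ex_minn bounded)
  | right _ => None
  end.

End RotaBaxter.

Section CayleyDickson.

Variable F : fieldType.

Definition mx2_conj (a : 'M[F]_2) : 'M[F]_2 :=
  let i0 : 'I_2 := ord0 in let i1 : 'I_2 := ord_max in
  \matrix_(i < 2, j < 2)
    if i == i0 then (if j == i0 then a i1 i1 else - a i0 i1)
    else (if j == i0 then - a i1 i0 else a i0 i0).

(* The pair (a, b) stands for a + v b. *)
Definition cayley : Type := ('M[F]_2 * 'M[F]_2)%type.
HB.instance Definition _ := GRing.Lmodule.on cayley.

(* The bilinear extension of a (v b) = v (\bar a b), (v b) a = v (a b) and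
   (v a) (v b) = b \bar a: the product of a + v b and c + v d. *)
Definition cayley_mul (x y : cayley) : cayley :=
  let: (a, b) := x in
  let: (c, d) := y in
  (a *m c + d *m mx2_conj b, mx2_conj a *m d + c *m b).

Lemma mx2_conj_linear : linear mx2_conj.
Proof.
move=> k a b; apply/matrixP => i j; rewrite !mxE.
by do 2!case: ifP => _; rewrite ?opprD ?mulrN.
Qed.
HB.instance Definition _ :=
  GRing.isLinear.Build F 'M[F]_2 'M[F]_2 *:%R mx2_conj mx2_conj_linear.

Lemma cayley_mul_bilinear :
  bilinear_for (GRing.Scale.Law.clone _ _ *:%R _)
    (GRing.Scale.Law.clone _ _ *:%R _) cayley_mul.
Proof.
split=> [[c d]|[a b]] k [x y] [z t]; congr pair => /=.
- by rewrite linearP /= mulmxDl mulmxDr -scalemxAl -scalemxAr scalerDr addrACA.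
- by rewrite linearP /= mulmxDl mulmxDr -scalemxAl -scalemxAr scalerDr addrACA.
- by rewrite mulmxDl mulmxDr -scalemxAl -scalemxAr scalerDr addrACA.
- by rewrite mulmxDl mulmxDr -scalemxAl -scalemxAr scalerDr addrACA.
Qed.
HB.instance Definition _ :=
  bilinear_isBilinear.Build F cayley cayley cayley *:%R *:%R cayley_mul
    cayley_mul_bilinear.

End CayleyDickson.

(* Main.v *)
Require Import Defs.
From HB Require Import structures.
From mathcomp Require Import all_boot all_order all_algebra.
From mathcomp Require Import boolp ring.
Set Implicit Arguments.
Unset Strict Implicit.
Unset Printing Implicit Defensive.
Import GRing.Theory.
Local Open Scope ring_scope.

(* C(F) is quadratic: xy + yx lies in Fx + Fy + F1 with trace coefficients.  Put
   e = R(1).  Comparing R(x)R(1) + R(1)R(x) with the Rota-Baxter identity shows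
   that R(R + lam) maps the whole algebra into the plane F1 + Fe.  If e is a
   scalar, it is 0 or -lam and R or R + lam annihilates that plane.  Otherwise
   the identity at (1, e) leaves three possibilities: R(e) = 0, R(e) = -lam e,
   or (R + lam)^2(1) = 0.  In the first case 1 is not in the image of R, so
   R(R + lam) has image in Fe and R^2(R + lam) = 0; the third case is the first
   one for R + lam, which is Rota-Baxter of weight -lam.  In the second case
   e + lam is not in the image of R, nor e in that of R + lam, so
   R(R + lam) = 0. *)

(** * The symmetry between R and R + lam *)

Section Shift.

Variables (F : fieldType) (A : lmodType F) (mul : {bilinear A -> A -> A}).
Variables (lam : F) (R : {linear A -> A}).

Definition rb_shift (x : A) : A := R x + lam *: x.

Lemma rb_shift_is_linear : linear rb_shift.
Proof.
move=> k x y; rewrite /rb_shift linearP !scalerDr addrACA; congr (_ + (_ + _)).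
by rewrite !scalerA mulrC.
Qed.
HB.instance Definition _ := GRing.isLinear.Build F A A *:%R rb_shift rb_shift_is_linear.

(** Both operators have the same argument z = R(x)y + xR(y) + lam xy on the right, and (R(x) + lam
    x)(R(y) + lam y) = R(z) + lam z. *)
Lemma rota_baxter_shift : rota_baxter mul lam R -> rota_baxter mul (- lam) rb_shift.
Proof.
move=> RB x y; rewrite /= /rb_shift.
have -> : mul (R x + lam *: x) y + mul x (R y + lam *: y) + - lam *: mul x y =
          mul (R x) y + mul x (R y) + lam *: mul x y.
  rewrite !(linearDl, linearDr) !(linearZl_LR, linearZr_LR) /= scaleNr.
  by rewrite addrA addrK addrAC.
rewrite -RB !(linearDl, linearDr) !(linearZl_LR, linearZr_LR) /= !scalerDr.
by rewrite !addrA.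
Qed.

End Shift.

(** * Rota-Baxter operators on a unital quadratic algebra *)

Section QuadraticAlgebra.

Variables (F : fieldType) (A : lmodType F) (mul : {bilinear A -> A -> A}).
Variables (one : A) (t : A -> F) (b : A -> A -> F).
Hypothesis char2 : 2 != 0 :> F.
Hypothesis one_neq0 : one != 0.
Hypothesis mul1l : forall x, mul one x = x.
Hypothesis mul1r : forall x, mul x one = x.
(** Polarised form of x^2 = t(x)x - n(x)1; [b] is minus the polar form of the norm n. *)
Hypothesis mul_sym : forall x y,
  mul x y + mul y x = t x *: y + t y *: x + b x y *: one.

Section Operator.

Variables (lam : F) (R : {linear A -> A}).
Hypothesis RB : rota_baxter mul lam R.
Local Notation e := (R one).
Local Notation Q := (rb_shift lam R).

Let comb (p q : F) : A := p *: e + q *: one.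

Lemma combD p q p' q' : comb p q + comb p' q' = comb (p + p') (q + q').
Proof. by rewrite /comb !scalerDl addrACA. Qed.

Lemma combZ k p q : k *: comb p q = comb (k * p) (k * q).
Proof. by rewrite /comb scalerDr !scalerA. Qed.

Lemma comb_scale_e k : k *: e = comb k 0.
Proof. by rewrite /comb scale0r addr0. Qed.

Lemma comb_scale_one k : k *: one = comb 0 k.
Proof. by rewrite /comb scale0r add0r. Qed.

Lemma comb_inj p q p' q' : (forall c, e <> c *: one) ->
  comb p q = comb p' q' -> p = p' /\ q = q'.
Proof.
move=> eN1 /eqP; rewrite -subr_eq0 -scaleN1r combZ combD /comb !mulN1r => /eqP E.
have pp : p - p' = 0.
  apply/eqP/negPn/negP => p0; apply: (eN1 (- (p - p')^-1 * (q - q'))).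
  apply: (scalerI p0); rewrite scalerA mulNr mulrN mulVKf// scaleNr.
  by apply/eqP; rewrite -addr_eq0 E.
move: E; rewrite pp scale0r add0r => /eqP; rewrite scaler_eq0 (negPf one_neq0) orbF.
by move/eqP/subr0_eq; move/subr0_eq: pp.
Qed.

Lemma rb_unitr x : mul (R x) e = R (Q x) + R (mul x e).
Proof. by rewrite RB !mul1r /rb_shift addrAC linearD. Qed.

Lemma rb_unitl x : mul e (R x) = R (Q x) + R (mul e x).
Proof. by rewrite RB !mul1l /rb_shift -addrA addrC linearD. Qed.

(** Sum of the identities at (x, 1) and (1, x); [mul_sym] eliminates xe + ex under R, so no product
    remains on the right. *)
Lemma rb_unit_sym x : mul (R x) e + mul e (R x) =
  R (Q x) *+ 2 + (t x *: R e + t e *: R x + b x e *: e).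
Proof.
by rewrite rb_unitr rb_unitl addrACA -mulr2n -linearD mul_sym !linearD !linearZ.
Qed.

Lemma double_inj (x y : A) : x *+ 2 = y *+ 2 -> x = y.
Proof. by rewrite -!scaler_nat; apply: scalerI. Qed.

Lemma rb_unit_sqr : mul e e = comb (t e) (b e e / 2).
Proof.
apply: double_inj; rewrite [LHS]mulr2n mul_sym.
rewrite -scaler_nat combZ mulrCA divff// mulr1 mulr_natl mulr2n.
by rewrite /comb scalerDl.
Qed.

(** At (1, 1) the identity reads e^2 = 2R(e) + lam e, while e^2 is a combination of e and 1; solve
    for R(e). *)
Lemma rb_square_one : exists s m, R e = comb s m /\ mul e e = comb (2 * s + lam) (2 * m).
Proof.
exists ((t e - lam) / 2), (b e e / 2 / 2); split; last first.
  by rewrite rb_unit_sqr; congr comb; field.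
have := rb_unitr one; rewrite mul1l rb_unit_sqr /rb_shift linearD linearZ /=.
rewrite addrAC -mulr2n => E; apply: double_inj; apply: (addIr (lam *: e)).
by rewrite -E -scaler_nat combZ comb_scale_e combD; congr comb; field.
Qed.

(** Expand R(x)e + eR(x) by [mul_sym] and compare with [rb_unit_sym]: the terms t(e)R(x) cancel, and
    R(e) is already a combination of e and 1. *)
Lemma rb_defect_span x : exists p q, R (Q x) = comb p q.
Proof.
have [s [m [Re _]]] := rb_square_one.
have E := rb_unit_sym x; rewrite mul_sym Re in E.
exists ((t (R x) - t x * s - b x e) / 2), ((b (R x) e - t x * m) / 2).
apply: double_inj; apply: (addIr (t x *: comb s m + t e *: R x + b x e *: e)).
rewrite -E -[X in _ = X + _]scaler_nat !combZ addrAC [RHS]addrCA [RHS]addrC.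
rewrite [in RHS]addrAC addrA !comb_scale_e comb_scale_one !combD.
by rewrite [RHS]addrAC combD; congr (comb _ _ + _); field.
Qed.

Lemma rb_unit_cases : (forall c, e <> c *: one) ->
  [\/ R e = 0, R e = - lam *: e | Q (Q one) = 0].
Proof.
move=> eN1; have [s [m [Re ee]]] := rb_square_one.
have := rb_unitr e; rewrite /rb_shift Re ee.
have -> : mul (comb s m) e = comb (s * (2 * s + lam) + m) (s * (2 * m)).
  rewrite {1}/comb linearDl !linearZl_LR /= mul1l ee combZ comb_scale_e combD.
  by congr comb; ring.
have Rcomb p q : R (comb p q) = comb (p * s + q) (p * m).
  by rewrite {1}/comb linearD !linearZ /= Re combZ comb_scale_e combD; congr comb; ring.
(* Coefficients of e and 1 in R(e)e = R(Q(e)) + R(e^2) give s(s + lam) = -2m and m(s + 2 lam) =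
   0. *)
rewrite comb_scale_e combD !Rcomb combD => /(comb_inj eN1)[/eqP E1 /eqP E2].
have {}E1 : s * (s + lam) = - 2 * m.
  apply/eqP; rewrite -subr_eq0 -oppr_eq0; rewrite -subr_eq0 in E1.
  by apply: etrans E1; congr (_ == 0); ring.
have {E2} : m * (s + 2 * lam) == 0.
  rewrite -oppr_eq0; rewrite -subr_eq0 in E2.
  by apply: etrans E2; congr (_ == 0); ring.
rewrite mulf_eq0 => /orP[/eqP m0|].
  move: E1; rewrite m0 mulr0 => /eqP; rewrite mulf_eq0 => /orP[/eqP s0|].
    by apply: Or31; rewrite s0 /comb !scale0r addr0.
  by rewrite addr_eq0 => /eqP sl; apply: Or32; rewrite sl comb_scale_e.
(* Here s = -2 lam and m = -lam^2, so Q(Q(1)) = R(e) + 2 lam e + lam^2 1 vanishes. *)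
rewrite addr_eq0 => /eqP sl; apply: Or33.
have {E1} ml : m = - lam ^+ 2.
  by apply: (mulfI char2); rewrite -[LHS]opprK -mulNr -E1 sl; ring.
rewrite /rb_shift linearD linearZ scalerDr /= Re scalerA !comb_scale_e comb_scale_one !combD sl ml.
by rewrite [X in comb X _](_ : _ = 0) ?[X in comb _ X](_ : _ = 0) /comb ?scale0r ?addr0 //; ring.
Qed.

Lemma rb_unit_trace s : (forall c, e <> c *: one) -> R e = s *: e -> t e = 2 * s + lam.
Proof.
move=> eN1 Re; have := rb_unitr one.
rewrite mul1l rb_unit_sqr /rb_shift linearD linearZ /= Re !comb_scale_e !combD.
by case/(comb_inj eN1) => -> _; ring.
Qed.

(** If R(y) = 1, the coefficients of 1 in [rb_unit_sym] at y give 3 lam = 0; with lam = 0 the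
    identity at (y, y) reads 1 = 2. *)
Lemma one_notin_image : (3 != 0 :> F) -> (forall c, e <> c *: one) -> R e = 0 ->
  forall y, R y <> one.
Proof.
move=> char3 eN1 Re y Ry.
have te : t e = lam.
  by rewrite (@rb_unit_trace 0) ?Re ?scale0r// mulr0 add0r.
have := rb_unit_sym y; rewrite /rb_shift linearD linearZ /= Ry mul1l mul1r Re te.
rewrite scaler0 add0r -mulr2n -!scaler_nat scalerDr scalerA.
rewrite !comb_scale_e !comb_scale_one !combD => /(comb_inj eN1)[_ /eqP].
rewrite [X in _ == X](_ : _ = 3 * lam); last by ring.
rewrite eq_sym mulf_eq0 (negPf char3) => /eqP lam0.
have := RB y y; rewrite lam0 scale0r addr0 Ry !(mul1l, mul1r) linearD Ry.
by move/eqP; rewrite -subr_eq0 opprD addrA subrr sub0r oppr_eq0 (negPf one_neq0).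
Qed.

(** If R(y) = e + lam 1, then R(y)e = eR(y) = 0 because e^2 = -lam e, and the coefficients of 1 in
    [rb_unit_sym] at y give lam^2 = 0. *)
Lemma unit_image_notin_image : lam != 0 -> (forall c, e <> c *: one) ->
  R e = - lam *: e -> forall y, R y <> e + lam *: one.
Proof.
move=> lam0 eN1 Re y Ry.
have te : t e = - lam by rewrite (rb_unit_trace eN1 Re); ring.
have ee : mul e e = - lam *: e.
  have := rb_unitr one; rewrite mul1l /rb_shift linearD linearZ /= Re => ->.
  by rewrite scaleNr addNr add0r.
have := rb_unit_sym y; rewrite /rb_shift linearD linearZ /= Ry.
rewrite linearDl linearDr linearZl_LR linearZr_LR /= mul1l mul1r ee linearD linearZ /= Re te.
rewrite !scalerDr !scalerA -!scaler_nat.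
rewrite !comb_scale_e !comb_scale_one !(combD, combZ) => /(comb_inj eN1)[_ /eqP].
rewrite [X in _ == X](_ : _ = lam * lam); last by ring.
by rewrite !addr0 eq_sym mulf_eq0 (negPf lam0).
Qed.

Lemma rb_nilpotent_unit : (3 != 0 :> F) -> (forall c, e <> c *: one) -> R e = 0 ->
  forall x, R (R (Q x)) = 0.
Proof.
move=> char3 eN1 Re x; have [p [q E]] := rb_defect_span x.
suff q0 : q = 0 by rewrite E q0 /comb scale0r addr0 linearZ /= Re scaler0.
apply/eqP/negPn/negP => q0.
(* Since R(p 1) = p e, subtracting p 1 from Q(x) removes the e-term of R(Q(x)) and leaves a preimage
   of q 1. *)
apply: (one_notin_image char3 eN1 Re (y := q^-1 *: (Q x - p *: one))).
rewrite linearZ linearB linearZ /= E /comb [_ + q *: _]addrC addrK scalerA mulVf//.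
by rewrite scale1r.
Qed.

End Operator.

Lemma rb_split_unit lam (R : {linear A -> A}) : rota_baxter mul lam R ->
  lam != 0 -> (forall c, R one <> c *: one) -> R (R one) = - lam *: R one ->
  forall x, R (rb_shift lam R x) = 0.
Proof.
move=> RB lam0 eN1 Re x; have [p [q E]] := rb_defect_span RB x.
have imR := unit_image_notin_image RB lam0 eN1 Re.
have q0 : q = 0.
  apply/eqP/negPn/negP => q0.
  (* R sends Q(x) to p e + q 1 and 1 to e; the coefficients are solved so that the image is e + lam
     1. *)
  apply: (imR ((lam / q) *: (rb_shift lam R x) + (1 - lam / q * p) *: one)).
  rewrite linearD !linearZ /= E scalerDr !scalerA divfK// addrAC -scalerDl.
  by rewrite [_ + (1 - _)]addrC subrK scale1r.
rewrite {}q0 scale0r addr0 in E.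
suff p0 : p = 0 by rewrite E p0 scale0r.
apply/eqP/negPn/negP => p0.
have RB' := rota_baxter_shift RB.
(* For Q, of weight -lam, the excluded value Q(1) - lam 1 is e, yet Q(R(x)/p) = e. *)
apply: (unit_image_notin_image RB' _ _ _ (y := p^-1 *: R x)).
- by rewrite oppr_eq0.
- move=> c; rewrite /= /rb_shift => /(canRL (addrK _)).
  by rewrite -scalerBl; apply: eN1.
- rewrite /= /rb_shift linearD linearZ /= Re opprK scaleNr addNr add0r.
  by rewrite scalerDr.
rewrite linearZ /= {1}/rb_shift -linearZ -linearD -/(rb_shift lam R x) E.
by rewrite scalerA mulVf// scale1r /= /rb_shift scaleNr addrK.
Qed.

Lemma rb_bound_quadratic lam : 3 != 0 :> F -> rb_bound mul lam 3.
Proof.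
move=> char3 R RB.
have comm x : R (rb_shift lam R x) = rb_shift lam R (R x).
  by rewrite /rb_shift linearD linearZ.
have [[c Re]|/forallNP eN1] := pselect (exists c, R one = c *: one).
  have Rspan x : exists p, R (rb_shift lam R x) = p *: one.
    have [p [q ->]] := rb_defect_span RB x.
    by exists (p * c + q); rewrite Re scalerA scalerDl.
  (* At (1, 1) the identity reads c^2 = 2c^2 + lam c. *)
  have : c * (c + lam) == 0.
    have := rb_unitr RB one; rewrite mul1l Re linearZr_LR /= mul1r.
    rewrite /rb_shift Re linearD !linearZ /= Re !scalerA -!scalerDl.
    move/eqP; rewrite -subr_eq0 -scalerBl scaler_eq0 (negPf one_neq0) orbF.
    by rewrite -oppr_eq0 => /eqP H; apply/eqP; rewrite -[RHS]H; ring.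
  rewrite mulf_eq0 addr_eq0 => /orP[/eqP c0|/eqP c0].
    exists 2%N => // x; have [p /= E] := Rspan x.
    by rewrite -/(rb_shift lam R x) E linearZ /= Re c0 scale0r scaler0.
  exists 1%N => // x; have [p /= E] := Rspan x.
  rewrite -!/(rb_shift lam R _) comm E linearZ /= /rb_shift Re c0 scaleNr addNr.
  by rewrite scaler0.
have caseA : R (R one) = 0 ->
    exists2 k : nat, (k <= 3)%N &
    forall x : A, iter k R (iter (3 - k) (fun y => R y + lam *: y) x) = 0.
  by move=> Re; exists 2%N => // x; apply: (rb_nilpotent_unit RB).
case: (rb_unit_cases RB eN1) => // Re.
  have [lam0|lam0] := eqVneq lam 0.
    by apply: caseA; rewrite Re lam0 oppr0 scale0r.
  exists 2%N => // x /=.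
  by rewrite -/(rb_shift lam R x) (rb_split_unit RB) ?linear0.
exists 1%N => // x /=; rewrite -!/(rb_shift lam R _) !comm.
(* Shifting Q by -lam gives back R, so the nilpotent case applied to Q yields Q(Q(R(x))) = 0. *)
have <- : rb_shift (- lam) (rb_shift lam R) x = R x.
  by rewrite /= /rb_shift scaleNr addrK.
apply: (rb_nilpotent_unit (rota_baxter_shift RB)) => // c.
rewrite /= /rb_shift => /(canRL (addrK _)).
by rewrite -scalerBl; apply: eN1.
Qed.

End QuadraticAlgebra.

(** * From bounds to the index *)

(** Keep k: the n - m extra factors R + lam act first, and the product for m kills their result. *)
Lemma rb_bound_leq (F : fieldType) (A : lmodType F) (mul : {bilinear A -> A -> A})
    lam m n : (m <= n)%N -> rb_bound mul lam m -> rb_bound mul lam n.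
Proof.
move=> le_mn bm R /bm[k le_km Rk]; exists k; first exact: leq_trans le_mn.
by move=> x; rewrite -(subnK le_mn) addnC -addnBAC// iterD Rk.
Qed.

Lemma rb_index_eqS (F : fieldType) (A : lmodType F) (mul : {bilinear A -> A -> A})
    lam m : rb_bound mul lam m.+1 -> ~ rb_bound mul lam m ->
  rb_index mul lam = Some m.+1.
Proof.
move=> bm nbm; rewrite /rb_index; case: pselect => [ex|[]]; last first.
  by exists m.+1; apply/asboolP.
congr Some; case: ex_minnP => n /asboolP bn /(_ m.+1 (introT (asboolP _) bm)) le_n.
apply/eqP; rewrite eqn_leq le_n /= ltnNge; apply/negP => le_nm.
exact/nbm/(rb_bound_leq le_nm).
Qed.

(** * C(F) as a quadratic algebra *)

Section Cayley.

Variable F : fieldType.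

Lemma matrix2P (a c : 'M[F]_2) :
  a ord0 ord0 = c ord0 ord0 -> a ord0 ord_max = c ord0 ord_max ->
  a ord_max ord0 = c ord_max ord0 -> a ord_max ord_max = c ord_max ord_max ->
  a = c.
Proof.
move=> h00 h01 h10 h11; apply/matrixP => i j.
have ord2 (k : 'I_2) : k = ord0 \/ k = ord_max.
  by case: k => [[|[|//]] ?]; [left|right]; apply: val_inj.
by case: (ord2 i) => ->; case: (ord2 j) => ->.
Qed.

Lemma sum_ord2 (f : 'I_2 -> F) : \sum_(i < 2) f i = f ord0 + f ord_max.
Proof. by rewrite big_ord_recl big_ord1; congr (_ + f _); apply: val_inj. Qed.

Definition cayley_one : cayley F := (1%:M, 0).

Definition cayley_tr (x : cayley F) : F := \tr x.1.

(* The polar form of the determinant; the norm of a + v b is det a - det b. *)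
Definition mx2_polar (a c : 'M[F]_2) : F :=
  a ord0 ord0 * c ord_max ord_max + a ord_max ord_max * c ord0 ord0
  - a ord0 ord_max * c ord_max ord0 - a ord_max ord0 * c ord0 ord_max.

Lemma cayley_mul1l x : cayley_mul cayley_one x = x.
Proof.
case: x => a c; congr pair; first by rewrite /= linear0 mulmx0 addr0 mul1mx.
have -> : mx2_conj 1%:M = 1%:M :> 'M[F]_2.
  by apply: matrix2P; rewrite !mxE /= ?mulr1n ?mulr0n ?oppr0.
by rewrite mul1mx mulmx0 addr0.
Qed.

Lemma cayley_mul1r x : cayley_mul x cayley_one = x.
Proof. by case: x => a c; congr pair; rewrite /= ?mulmx1 ?mul1mx ?mul0mx ?mulmx0 ?addr0 ?add0r. Qed.

Lemma cayley_mul_sym x y : cayley_mul x y + cayley_mul y x =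
  cayley_tr x *: y + cayley_tr y *: x
  + (mx2_polar x.2 y.2 - mx2_polar x.1 y.1) *: cayley_one.
Proof.
case: x y => [a c] [a' c']; rewrite /cayley_tr /mx2_polar /= /mxtrace.
by congr pair; apply: matrix2P; rewrite /= !(mxE, sum_ord2) /= ?mulr1n ?mulr0n; ring.
Qed.

(** * Operators showing that 2 is not a bound *)

Definition mx2 (p q r s : F) : 'M[F]_2 :=
  \matrix_(i < 2, j < 2)
    if i == ord0 then (if j == ord0 then p else q)
    else (if j == ord0 then r else s).

(* On M_2(F) the weight-0 operator with e21 |-> -e11 |-> -e12; its square is not
   zero. *)
Definition cayley_rb0 (x : cayley F) : cayley F :=
  (mx2 (- x.1 ord_max ord0) (x.1 ord0 ord0) 0 0, 0).

(* On M_2(F) this sends e22 |-> lam e11 |-> 0.  On vM_2(F), the sum of the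
   bimodules of the two columns, each of square zero, it is 0 on the first
   and -lam on the second. *)
Definition cayley_rb (lam : F) (x : cayley F) : cayley F :=
  (mx2 (lam * x.1 ord_max ord_max) (- lam * x.1 ord0 ord_max) 0 0,
   mx2 0 (- lam * x.2 ord0 ord_max) 0 (- lam * x.2 ord_max ord_max)).

Lemma cayley_rb0_is_linear : linear cayley_rb0.
Proof.
by move=> k [a c] [a' c']; congr pair; apply: matrix2P; rewrite /= !mxE /=; ring.
Qed.
HB.instance Definition _ := GRing.isLinear.Build F (cayley F) (cayley F) *:%R
  cayley_rb0 cayley_rb0_is_linear.

Lemma cayley_rb_is_linear lam : linear (cayley_rb lam).
Proof.
by move=> k [a c] [a' c']; congr pair; apply: matrix2P; rewrite /= !mxE /=; ring.
Qed.
HB.instance Definition _ lam := GRing.isLinear.Build F (cayley F) (cayley F) *:%R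
  (cayley_rb lam) (cayley_rb_is_linear lam).

Lemma rota_baxter_cayley_rb0 : rota_baxter (@cayley_mul F) 0 cayley_rb0.
Proof.
move=> [a c] [a' c'].
by congr pair; apply: matrix2P; rewrite /= !(mxE, sum_ord2) /=; ring.
Qed.

Lemma rota_baxter_cayley_rb lam : rota_baxter (@cayley_mul F) lam (cayley_rb lam).
Proof.
move=> [a c] [a' c'].
by congr pair; apply: matrix2P; rewrite /= !(mxE, sum_ord2) /=; ring.
Qed.

Lemma rb_bound_cayley2 lam : ~ rb_bound (@cayley_mul F) lam 2.
Proof.
have [->|lam0] := eqVneq lam 0.
  move=> /(_ _ rota_baxter_cayley_rb0)[k le_k2].
  (* In weight 0 every k gives R^2, which sends e21 to -e12. *)
  move=> /(_ (mx2 0 0 1 0, 0)) /(congr1 (fun x : cayley F => x.1 ord0 ord_max)).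
  case: k le_k2 => [|[|[|//]]] _; rewrite /= !mxE /= ?mul0r ?addr0 => /eqP;
    by rewrite oppr_eq0 oner_eq0.
move=> /(_ _ (rota_baxter_cayley_rb lam))[k le_k2].
(* On e22 + v e12 each product leaves an entry lam^2: at e22 for k = 0, at e11 for k = 1, at v e12
   for k = 2. *)
move=> /(_ (mx2 0 0 0 1, mx2 0 1 0 0)) E.
have l2 : lam * lam != 0 by rewrite mulf_neq0.
have E1 := congr1 (fun x : cayley F => x.1 ord_max ord_max) E.
have E2 := congr1 (fun x : cayley F => x.1 ord0 ord0) E.
have E3 := congr1 (fun x : cayley F => x.2 ord0 ord_max) E.
case/eqP: l2; case: k le_k2 {E} E1 E2 E3 => [|[|[|//]]] _;
  rewrite /= !mxE /= => E1 E2 E3.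
- by rewrite -[RHS]E1; ring.
- by rewrite -[RHS]E2; ring.
- by rewrite -[RHS]E3; ring.
Qed.

End Cayley.
Arguments cayley_one {F}.

Theorem proposition3 (F : closedFieldType)
    (charF2 : 2%N \notin [pchar F]) (charF3 : 3%N \notin [pchar F]) (lam : F) :
  rb_index (@cayley_mul F) lam = Some 3%N.
Proof.
have two_neq0 : 2 != 0 :> F by move: charF2; rewrite inE.
have three_neq0 : 3 != 0 :> F by move: charF3; rewrite inE.
have one_neq0 : cayley_one != 0 :> cayley F.
  apply/eqP => /(congr1 (fun x : cayley F => x.1 ord0 ord0)) /eqP.
  by rewrite !mxE oner_eq0.
apply: rb_index_eqS (@rb_bound_cayley2 F lam).
exact: (rb_bound_quadratic two_neq0 one_neq0 (@cayley_mul1l F) (@cayley_mul1r F)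
  (@cayley_mul_sym F)).
Qed.
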